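(* Let $(X,\mathcal F,T,P)$ be a target problem and let $\mathrm{Str}=(\mathrm{Str}_n)_n$ be a target algorithm with $\mathrm{Str}_n(X,\mathcal F,T,P)=(X,\mathcal F_n,T,P_n)$. Then, for every $x\in X$, $P_n(x,\cdot)$ converges totally to $P(x,\cdot)$ (restricted to $\vee_n\mathcal F_n$) on the topological space $(X,\varrho_P)$ as $n\to\infty$.
   Context: Standing setting. $(X,\mathcal X)$ is a measurable space and $T\in\mathcal X$ is a fixed set (the target). A random variable is a measurable $f:(X,\mathcal X)\to(\mathbb R,\mathcal B_{\mathbb R})$; it is discrete if it takes at most countably many values. $\pi_f$ is the equivalence relation $x\,\pi_f\,y\iff f(x)=f(y)$. Relations are ordered by inclusion as subsets of $X\times X$. It is assumed throughout that $(X,\mathcal X)$ satisfies (A0): for all random variables $f,g$, $\pi_f\subseteq\pi_g$ implies $\sigma(f)\supseteq\sigma(g)$. An equivalence relation on a measurable space is measurable (discrete) if it equals $\pi_f$ for some (discrete) random variable $f$ on that space. Target problems. For a sub-$\sigma$-algebra $\mathcal F\subseteq\mathcal X$ with $T\in\mathcal F$, a transition probability on $(X,\mathcal F)$ is $P:X\times\mathcal F\to[0,1]$ with $P(x,\cdot)$ a probability measure on $\mathcal F$ for every $x\in X$ and $P(\cdot,F)$ $\mathcal F$-measurable for every $F\in\mathcal F$. Set $P^1=P$, $P^{n+1}(x,F)=\int_X P(x,dy)P^n(y,F)$. A target problem is $(X,\mathcal F,T,P)$ with such $\mathcal F,P$; it is simple if $\mathcal F$ is generated by an at most countable partition of $X$.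 A strategy is a sequence $(\mathrm{Str}_n)_n$ of maps from target problems to simple target problems. Topology $\varrho_P$. Fix $\beta\in(0,1)$. $\varrho_P$ is the topology on $X$ induced by the pseudometric $d_P(x,y)=\sum_{n\ge1}\beta^n|P^n(x,T)-P^n(y,T)|$. Total convergence. Let $(\mathcal X_n)_n$ be a filtration on $X$, $\mathcal X_\infty=\vee_n\mathcal X_n$, let $\nu_n$ be a probability measure on $\mathcal X_n$ and $\nu_\infty$ a probability measure on $\mathcal X_\infty$, and let $\tau$ be a topology on $X$. $\nu_n$ converges totally to $\nu_\infty$ on $(X,\tau)$ if, for every choice of probability measures $\bar\nu_n$ on $\mathcal X_\infty$ with $\bar\nu_n|_{\mathcal X_n}=\nu_n$ for all $n$, $\bar\nu_n$ converges weakly to $\nu_\infty$ on $(X,\tau)$, i.e. $\int h\,d\bar\nu_n\to\int h\,d\nu_\infty$ for all bounded $\tau$-continuous $h:X\to\mathbb R$. Here it is applied with $\mathcal X_n=\mathcal F_n$ and $\tau=\varrho_P$; the $\varrho_P$-open sets belong to $\vee_n\mathcal F_n$. Target algorithms. Let $S=\{p=(p_i)_{i\ge1}: p_i\ge0,\ \sum_i p_i\le1\}\subset\ell_1$ with the $\sigma$-algebra $\mathcal B_S$ induced by the product Borel $\sigma$-algebra of $[0,1]^{\mathbb N}$. An $\epsilon$-equivalence on $S$ is a discrete equivalence $\sim_\epsilon$ on $(S,\mathcal B_S)$ such that $\|p-q\|_1<\epsilon$ whenever $p\sim_\epsilon q$. A target algorithm is a strategy obtained as follows. Choose $\epsilon_n>0$,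 $\epsilon_n\to0$, and for each $n$ an $\epsilon_n$-equivalence $\sim_{\epsilon_n}$ on $S$. Given $(X,\mathcal F,T,P)$, let $\mathcal F_0=\sigma(T)=\{\varnothing,T,X\setminus T,X\}$ with $\pi_0$ the equivalence with classes $T$, $X\setminus T$. For $n\ge1$, let $(A_i^{(n-1)})_i$ be an enumeration of the at most countable partition $X/\pi_{n-1}$ generating $\mathcal F_{n-1}$, and set $x\,\pi_n\,y\iff x\,\pi_{n-1}\,y$ and $(P(x,A_i^{(n-1)}))_i\sim_{\epsilon_n}(P(y,A_i^{(n-1)}))_i$ (finite sequences are extended by zeros), $\mathcal F_n=\sigma(X/\pi_n)$. Choose a probability measure $\mu$ on $\vee_n\mathcal F_n$ with $\mu(F)>0$ for every $n$ and every nonempty $F\in\mathcal F_n$ (such $\mu$ exists). For $F\in\mathcal F_n$ put $Y^F(\omega)=P(\omega,F)$, which is a $\vee_n\mathcal F_n$-measurable random variable, and $P_n(x,F)=\mathbb E_\mu[Y^F\mid\mathcal F_n](x)$ for all $x\in X$, i.e. $P_n(x,F)=\mu([x]_n)^{-1}\int_{[x]_n}P(z,F)\,\mu(dz)$ with $[x]_n$ the $\pi_n$-class of $x$. Then $\mathrm{Str}_n(X,\mathcal F,T,P)=(X,\mathcal F_n,T,P_n)$. *)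

(* Defs.v *)
From HB Require Import structures.
From mathcomp Require Import all_boot all_order all_algebra.
From mathcomp Require Import all_classical all_reals all_analysis.
From mathcomp Require Import measurable_realfun.

Set Implicit Arguments.
Unset Strict Implicit.
Unset Printing Implicit Defensive.

Import Order.TTheory GRing.Theory Num.Theory.
Import numFieldNormedType.Exports.

Local Open Scope classical_set_scope.
Local Open Scope ring_scope.

Section measurable_equivalences.
Context {R : realType} d {X : measurableType d}.

Definition ker_rel (f : X -> R) (x y : X) : Prop := f x = f y.

Definition discrete_rv (f : {mfun X >-> R}) := countable (range f).

Definition discrete_equivalence (r : X -> X -> Prop) :=
  exists2 f : {mfun X >-> R}, discrete_rv f & r = ker_rel f.

End measurable_equivalences.

Definition assumption_A0 (R : realType) d (X : measurableType d) :=
  forall f g : {mfun X >-> R},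
    (forall x y, ker_rel f x y -> ker_rel g x y) ->
    g_sigma_algebra_preimage g `<=` g_sigma_algebra_preimage f.

(* The ambient space X is the carrier of its own sub-sigma-algebras:
   [g_sigma_algebraType F] is X endowed with <<s F>>, which is F itself because
   of [tp_sigma_algebra].  Kernels only carry information on F: the value of
   [tp_ker x B] for B outside F is irrelevant. *)
Record target_problem (R : realType) d (X : measurableType d) (T : set X) := {
  tp_sigma : set (set X) ;
  tp_sigma_algebra : sigma_algebra setT tp_sigma ;
  tp_sigma_sub : tp_sigma `<=` measurable ;
  tp_target : tp_sigma T ;
  tp_ker : X -> probability (g_sigma_algebraType tp_sigma) R ;
  tp_ker_measurable : forall B, tp_sigma B ->
    measurable_fun [set: g_sigma_algebraType tp_sigma] (tp_ker ^~ B) }.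

Section target_problems.
Context {R : realType} d {X : measurableType d} {T : set X}.

Definition simple (pb : target_problem R T) :=
  exists C : set (set X), [/\ countable C, partition C id [set: X] &
    tp_sigma pb = <<s C >>].

Record simple_target_problem := {
  stp_problem :> target_problem R T ;
  stp_simple : simple stp_problem }.

Definition strategy := nat -> target_problem R T -> simple_target_problem.

(* [ker_iter pb n x F] is P^(n+1)(x, F). *)
Fixpoint ker_iter (pb : target_problem R T) (n : nat) (x : X) (F : set X)
    : \bar R :=
  if n is n'.+1 then \int[tp_ker pb x]_y ker_iter pb n' y F
  else tp_ker pb x F.

(* d_P with values in \bar R; it is finite since 0 < beta < 1. *)
Definition rho_dist (beta : R) (pb : target_problem R T) (x y : X) : \bar R :=
  (\sum_(0 <= n <oo)
    (beta ^+ n.+1 * `|fine (ker_iter pb n x T) - fine (ker_iter pb n y T)|)%:E)%E.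

Definition rho_space (beta : R) (beta01 : 0 < beta < 1)
  (pb : target_problem R T) : Type := X.

End target_problems.
Arguments strategy R {d X} T.

Section rho_topology.
Context {R : realType} d {X : measurableType d} {T : set X}.
Variables (beta : R) (beta01 : 0 < beta < 1) (pb : target_problem R T).
Local Notation Y := (rho_space beta01 pb).

HB.instance Definition _ := Pointed.on Y.

Let ball (x : Y) (e : R) : set Y := [set y | (rho_dist beta pb x y < e%:E)%E].
Let ent : set_system (Y * Y) := entourage_ ball.

HB.instance Definition _ := hasNbhs.Build Y (nbhs_ ent).

Let rho_term_ge0 (x y : X) n :
  (0 <= (beta ^+ n.+1 *
    `|fine (ker_iter pb n x T) - fine (ker_iter pb n y T)|)%:E)%E.
Proof.
case/andP: beta01 => b0 _.
by rewrite lee_fin mulr_ge0// exprn_ge0// ltW.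
Qed.

Let ball_center (x : Y) (e : R) : 0 < e -> ball x e x.
Proof.
move=> e0; rewrite /ball /= /rho_dist eseries0 ?lte_fin// => n _ _.
by rewrite subrr normr0 mulr0.
Qed.

Let ball_sym (x y : Y) (e : R) : ball x e y -> ball y e x.
Proof.
by rewrite /ball /= /rho_dist; under eq_eseriesr do rewrite distrC.
Qed.

Let ball_triangle (x y z : Y) (e1 e2 : R) :
  ball x e1 y -> ball y e2 z -> ball x (e1 + e2) z.
Proof.
rewrite /ball /= => xy yz; rewrite EFinD.
apply: (le_lt_trans _ (lteD xy yz)).
rewrite /rho_dist -nneseriesD; [|by move=> *; exact: rho_term_ge0..].
apply: lee_nneseries => n *; first exact: rho_term_ge0.
rewrite -EFinD lee_fin -mulrDr; apply: ler_wpM2l; last exact: ler_distD.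
by case/andP: beta01 => b0 _; rewrite exprn_ge0// ltW.
Qed.

HB.instance Definition _ := @Nbhs_isPseudoMetric.Build R Y
  ent erefl ball ball_center ball_sym ball_triangle erefl.

End rho_topology.

Section total_convergence.
Context {R : realType} {Y : ptopologicalType}.

Definition weakly_cvg (G : set (set Y))
    (nu : nat -> probability (g_sigma_algebraType G) R)
    (nuoo : probability (g_sigma_algebraType G) R) :=
  forall h : Y -> R, continuous h -> (exists M : R, forall y, `|h y| <= M) ->
    (\int[nu n]_y (h y)%:E @[n --> \oo] --> \int[nuoo]_y (h y)%:E)%E.

(* Meant for a filtration G; [g_sigma_algebraType (\bigcup_n G n)] carries the
   sigma-algebra generated by the union. *)
Definition totally_cvg (G : nat -> set (set Y))
    (nu : forall n, probability (g_sigma_algebraType (G n)) R)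
    (nuoo : probability (g_sigma_algebraType (\bigcup_n G n)) R) :=
  forall nub : nat -> probability (g_sigma_algebraType (\bigcup_n G n)) R,
    (forall n B, G n B -> nub n B = nu n B) -> weakly_cvg nub nuoo.

End total_convergence.

Section restriction.
Context {R : realType} {X : pointedType} (G H : set (set X)).
Hypothesis GH : G `<=` <<s H>>.

Let restrict_id : g_sigma_algebraType H -> g_sigma_algebraType G := id.

Let measurable_restrict_id : measurable_fun setT restrict_id.
Proof.
move=> _ B mB; rewrite setTI preimage_id.
by apply: (smallest_sub (smallest_sigma_algebra setT H) GH).
Qed.

HB.instance Definition _ :=
  isMeasurableFun.Build _ _ _ _ restrict_id measurable_restrict_id.

Definition restrict_prob (mu : probability (g_sigma_algebraType H) R) :
    probability (g_sigma_algebraType G) R :=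
  distribution mu restrict_id.

Lemma restrict_probE mu (B : set X) : restrict_prob mu B = mu B.
Proof. by []. Qed.

End restriction.

Section subprobability_sequences.
Context {R : realType}.

Record subprob_seq := SubprobSeq {
  sps :> nat -> R ;
  sps_ge0 : forall i, 0 <= sps i ;
  sps_le1 : (\sum_(0 <= i <oo) (sps i)%:E <= 1)%E }.

HB.instance Definition _ := gen_eqMixin subprob_seq.
HB.instance Definition _ := gen_choiceMixin subprob_seq.

Let zero_le1 : (\sum_(0 <= i <oo) (0 : R)%:E <= 1 :> \bar R)%E.
Proof. by rewrite eseries0. Qed.

HB.instance Definition _ :=
  isPointed.Build subprob_seq (SubprobSeq (fun=> lexx 0) zero_le1).

Definition product_borel : set (set (nat -> R)) :=
  <<s \bigcup_i preimage_set_system setT (fun u : nat -> R => u i) measurable >>.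

(* The trace of the product Borel sigma-algebra; tracing from R^nat or from
   [0, 1]^nat gives the same sigma-algebra. *)
Definition subprob_seq_measurable : set (set subprob_seq) :=
  preimage_set_system setT sps product_borel.

Let subprob_seq_sigma_algebra : sigma_algebra setT subprob_seq_measurable.
Proof. exact/sigma_algebra_preimage/smallest_sigma_algebra. Qed.

Let subprob_seq_measurable0 : subprob_seq_measurable set0.
Proof. by case: subprob_seq_sigma_algebra. Qed.

Let subprob_seq_measurableC A :
  subprob_seq_measurable A -> subprob_seq_measurable (~` A).
Proof. by case: subprob_seq_sigma_algebra => _ mC _ /mC; rewrite setTD. Qed.

Let subprob_seq_measurable_bigcup (F : (set subprob_seq)^nat) :
  (forall i, subprob_seq_measurable (F i)) ->
  subprob_seq_measurable (\bigcup_i F i).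
Proof. by case: subprob_seq_sigma_algebra => _ _ mU; exact: mU. Qed.

HB.instance Definition _ := @isMeasurable.Build default_measure_display
  subprob_seq subprob_seq_measurable subprob_seq_measurable0
  subprob_seq_measurableC subprob_seq_measurable_bigcup.

End subprobability_sequences.
Arguments subprob_seq R : clear implicits.

Definition eps_equivalence (R : realType) (eps : R)
    (sim : subprob_seq R -> subprob_seq R -> Prop) :=
  discrete_equivalence (R := R) sim /\
  forall p q, sim p q -> (\sum_(0 <= i <oo) `|p i - q i|%:E < eps%:E)%E.

Section algorithms.
Context {R : realType} d {X : measurableType d} {T : set X}.

Definition rel_class (r : X -> X -> Prop) (x : X) : set X := [set y | r x y].

Definition rel_classes (r : X -> X -> Prop) : set (set X) := range (rel_class r).

(* A finite family is padded with empty sets, which have probability 0: this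
   extends the finite sequences (P(x, A_i))_i by zeros. *)
Definition enumerates (A : nat -> set X) (C : set (set X)) :=
  set_bij setT C A \/
  exists2 n, set_bij `I_n C A & forall i, (n <= i)%N -> A i = set0.

Section construction.
Variables (pb : target_problem R T).
Variables (sim : nat -> subprob_seq R -> subprob_seq R -> Prop).
Variables (A : nat -> nat -> set X).

(* [p] and [q] are the sequences (P(x, A_i))_i and (P(y, A_i))_i seen as
   elements of [subprob_seq]. *)
Fixpoint algo_rel (n : nat) (x y : X) : Prop :=
  if n is n'.+1 then
    algo_rel n' x y /\
    exists p q : subprob_seq R,
      [/\ forall i, (p i)%:E = tp_ker pb x (A n' i),
          forall i, (q i)%:E = tp_ker pb y (A n' i) & sim n p q]
  else T x <-> T y.

Definition algo_sigma (n : nat) : set (set X) := <<s rel_classes (algo_rel n) >>.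

(* A version of the conditional expectation of P(., F) given F_n under mu: on
   the atom [x]_n it is mu([x]_n)^-1 * \int_[x]_n P(z, F) mu(dz).  It is the
   only version as soon as mu charges every atom, which [target_algorithm]
   requires. *)
Definition algo_ker
    (mu : probability (g_sigma_algebraType (\bigcup_n algo_sigma n)) R)
    (n : nat) (x : X) (F : set X) : \bar R :=
  let C := rel_class (algo_rel n) x in
  (((fine (mu C))^-1)%:E * \int[mu]_(z in C) tp_ker pb z F)%E.

End construction.

(* [eps] and [sim] are used from index 1 on: algo_rel n.+1 involves sim n.+1.
   The enumerations [A n] and the measure [mu] are chosen for each problem. *)
Definition target_algorithm (Str : strategy R T) :=
  exists (eps : nat -> R) (sim : nat -> subprob_seq R -> subprob_seq R -> Prop),
  [/\ forall n, (0 < n)%N -> 0 < eps n,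
      eps n @[n --> \oo] --> (0 : R),
      forall n, (0 < n)%N -> eps_equivalence (eps n) (sim n) &
      forall pb : target_problem R T,
      exists2 A : nat -> nat -> set X,
        forall n, enumerates (A n) (rel_classes (algo_rel pb sim A n)) &
      exists mu : probability (g_sigma_algebraType
                                 (\bigcup_n algo_sigma pb sim A n)) R,
      [/\ forall n F, algo_sigma pb sim A n F -> F !=set0 -> (0 < mu F)%E,
          forall n, tp_sigma (Str n pb) = algo_sigma pb sim A n &
          forall n x F, algo_sigma pb sim A n F ->
            tp_ker (Str n pb) x F = algo_ker mu n x F]].

End algorithms.

Section algorithm_measurability.
Context {R : realType} d {X : measurableType d} {T : set X}.
Variable pb : target_problem R T.
Local Notation M := (g_sigma_algebraType (tp_sigma pb)).

Let subprob_seq_eq (p q : subprob_seq R) : (forall i, p i = q i) -> p = q.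
Proof.
case: p q => [u u0 u1] [v v0 v1] /= /funext uv; subst v.
by congr SubprobSeq; exact: Prop_irrelevance.
Qed.

Lemma measurable_profile (A : nat -> set M) :
  (forall i, measurable (A i)) -> trivIset setT A ->
  exists2 Phi : M -> subprob_seq R, measurable_fun setT Phi &
    forall x i, (Phi x i)%:E = tp_ker pb x (A i).
Proof.
move=> mA tA.
have fE x i : (fine (tp_ker pb x (A i)))%:E = tp_ker pb x (A i).
  by rewrite fineK// fin_num_measure.
have ge0 x i : 0 <= fine (tp_ker pb x (A i)) by exact: fine_ge0.
have le1 x : (\sum_(0 <= i <oo) (fine (tp_ker pb x (A i)))%:E <= 1)%E.
  under eq_eseriesr do rewrite fE.
  rewrite -measure_semi_bigcup//; last exact: bigcup_measurable.
  by apply: probability_le1; exact: bigcup_measurable.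
pose Phi x := SubprobSeq (ge0 x) (le1 x).
exists Phi => [_ _ [B mB <-]|x i]; last by rewrite /= fE.
pose S := image_set_system setT (sps \o Phi) (@measurable _ M).
have SS : sigma_algebra setT S.
  by apply: sigma_algebra_image; exact: sigma_algebra_measurable.
suff /(_ _ mB) : product_borel `<=` S by rewrite /S /image_set_system /= !setTI.
apply: smallest_sub => // _ [i _ [C mC <-]].
rewrite /S /image_set_system /= !setTI.
have mf : measurable_fun [set: M] (fun x => fine (tp_ker pb x (A i))).
  apply: measurableT_comp => //; apply: tp_ker_measurable.
  have := mA i; rewrite /measurable /= sigma_algebra_id//.
  exact: tp_sigma_algebra.
by have := mf measurableT C mC; rewrite setTI.
Qed.

Let equivalence_trivIset (r : X -> X -> Prop) (A : nat -> set X) :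
  (forall x y, r x y -> r y x) -> (forall x y z, r x y -> r y z -> r x z) ->
  enumerates A (rel_classes r) -> trivIset setT A.
Proof.
move=> rC rT eA.
have cl_eq x y z : r x z -> r y z -> rel_class r x = rel_class r y.
  move=> xz yz; apply/seteqP; split => w /= h.
    by apply: (rT _ z) => //; apply: (rT _ x) => //; exact: rC.
  by apply: (rT _ z) => //; apply: (rT _ y) => //; exact: rC.
have Aeq i j z : rel_classes r (A i) -> rel_classes r (A j) ->
    A i z -> A j z -> A i = A j.
  by move=> [x _ <-] [y _ <-]; exact: cl_eq.
case: eA => [[fA iA _]|[n [fA iA _] A0]] i j _ _ [z [Aiz Ajz]].
  by apply: iA; rewrite ?inE//; apply: (Aeq _ _ z) => //; exact: fA.
have lt_n k : A k z -> (k < n)%N.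
  by move=> Akz; rewrite ltnNge; apply/negP => /A0 Ak0; rewrite Ak0 in Akz.
have [ni nj] := (lt_n _ Aiz, lt_n _ Ajz).
by apply: iA; rewrite ?inE//; apply: (Aeq _ _ z) => //; exact: fA.
Qed.

Let enumerates_measurable (r : X -> X -> Prop) (A : nat -> set M) :
  (forall x, @measurable _ M (rel_class r x)) ->
  enumerates A (rel_classes r) -> forall i, measurable (A i).
Proof.
move=> mr [[fA _ _] i|[n [fA _ _] A0] i].
  by have [//|x _ <-] := fA i.
have [/A0 ->//|ni] := leqP n i.
by have [//|x _ <-] := fA i.
Qed.

Lemma algo_rel_measurable sim A :
  (forall n, (0 < n)%N -> discrete_equivalence (R := R) (sim n)) ->
  (forall n, enumerates (A n) (rel_classes (algo_rel pb sim A n))) ->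
  forall n x, @measurable _ M (rel_class (algo_rel pb sim A n) x).
Proof.
move=> dsim eA n.
suff : [/\ forall x y, algo_rel pb sim A n x y -> algo_rel pb sim A n y x,
    forall x y z, algo_rel pb sim A n x y -> algo_rel pb sim A n y z ->
      algo_rel pb sim A n x z &
    forall x, @measurable _ M (rel_class (algo_rel pb sim A n) x)] by case.
elim: n => [|n [rC rT mr]].
  have mT : @measurable _ M T.
    by apply: sub_sigma_algebra; exact: tp_target.
  split => [x y|x y z|x] /=; [by move=> []|by move=> [? ?] [? ?]; split; auto|].
  have [Tx|Tx] := pselect (T x).
    rewrite (_ : rel_class _ _ = T)//.
    by apply/seteqP; split => y /=; [case=> /(_ Tx)|].
  rewrite (_ : rel_class _ _ = ~` T); first exact: measurableC.
  apply/seteqP; split => y /=; first by move=> [_ h] /h.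
  by move=> nTy; split.
have mA := enumerates_measurable mr (eA n).
have tA := equivalence_trivIset rC rT (eA n).
have [Phi mPhi PhiE] := measurable_profile mA tA.
have [f _ simE] := dsim n.+1 isT.
have stepE x y : algo_rel pb sim A n.+1 x y <->
    algo_rel pb sim A n x y /\ f (Phi x) = f (Phi y).
  split=> /= -[rxy]; last first.
    by move=> h; split=> //; exists (Phi x), (Phi y); split=> //; rewrite simE.
  move=> [p [q [pE qE]]]; rewrite simE /ker_rel => fpq; split=> //.
  rewrite (_ : Phi x = p); last first.
    by apply: subprob_seq_eq => i; apply: EFin_inj; rewrite PhiE pE.
  by rewrite (_ : Phi y = q)//; apply: subprob_seq_eq => i; apply: EFin_inj;
    rewrite PhiE qE.
split.
- by move=> x y /stepE[/rC rxy fxy]; apply/stepE.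
- by move=> x y z /stepE[xy fxy] /stepE[yz fyz]; apply/stepE;
    split; [exact: rT yz|rewrite fxy].
- move=> x.
  rewrite (_ : rel_class _ x = rel_class (algo_rel pb sim A n) x `&`
      (setT `&` (f \o Phi) @^-1` [set f (Phi x)])); last first.
    apply/seteqP; split => y; first by move=> /stepE[].
    by move=> [? [_ ?]]; apply/stepE.
  apply: measurableI; first exact: mr.
  by apply: (measurableT_comp (measurable_funPT f) mPhi).
Qed.

Lemma target_algorithm_sub (Str : strategy R T) : target_algorithm Str ->
  \bigcup_n tp_sigma (Str n pb) `<=` <<s tp_sigma pb >>.
Proof.
move=> [eps [sim [_ _ esim /(_ pb)[A eA [mu [_ sE _]]]]]] B [n _].
rewrite sE; apply: smallest_sub B; first exact: smallest_sigma_algebra.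
move=> _ [x _ <-]; apply: algo_rel_measurable => // k k0.
by have [] := esim k k0.
Qed.

End algorithm_measurability.

(* Main.v *)
Require Import Defs.
From HB Require Import structures.
From mathcomp Require Import all_boot all_order all_algebra.
From mathcomp Require Import all_classical all_reals all_analysis.
From mathcomp Require Import measurable_realfun lra.

(* If y and z are pi_(n+1)-equivalent then P(y, .) and P(z, .) are
   eps_(n+1)-close in total variation on F_n.  Two consequences: by induction on
   k the map P^k(., T) has a uniformly vanishing oscillation on the classes of
   pi_n as n grows, so these classes shrink to points for d_P; and, averaging
   over [x]_n, P_n(x, .) and P(x, .) are eps_n-close on F_m for m < n.
   For h bounded and continuous let h_m(y) be the infimum of h on [y]_m: it is
   F_m-measurable, h_m <= h, and h_m -> h pointwise because the classes shrink.
   Hence, for extensions nu_n of P_n(x, .),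
   liminf_n \int h dnu_n >= lim_n \int h_m dP_n(x, .) = \int h_m dP(x, .),
   which tends to \int h dP(x, .) as m grows; the same bound for - h
   gives the convergence. *)

Set Implicit Arguments.
Unset Strict Implicit.
Unset Printing Implicit Defensive.

Import Order.TTheory GRing.Theory Num.Theory.
Import numFieldNormedType.Exports.

Local Open Scope classical_set_scope.
Local Open Scope ring_scope.

(** * Integrals of functions constant on countably many pieces, and of bounded functions *)

Section countable_partitions.
Context {d} {Y : measurableType d} {R : realType}.
Variables (A : nat -> set Y) (c : nat -> R) (g : Y -> R).
Hypotheses (mA : forall i, measurable (A i)) (AT : \bigcup_i A i = setT).
Hypothesis gc : forall i y, A i y -> g y = c i.

Lemma measurable_fun_partition : measurable_fun setT g.
Proof.
move=> _ B _; rewrite setTI.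
rewrite (_ : g @^-1` B = \bigcup_(i in [set i | B (c i)]) A i); last first.
  apply/seteqP; split => [y By|y [i Bi Ay]]; last by rewrite /= (gc Ay).
  have [i _ Ay] : (\bigcup_i A i) y by rewrite AT.
  by exists i => //=; rewrite -(gc Ay).
by apply: bigcup_measurable => i _; exact: mA.
Qed.

(** Countable additivity over the pieces. A piece may be empty, with an arbitrary [c i], because its
    measure vanishes; padded enumerations are therefore covered. *)
Lemma ge0_integral_partition (nu : {measure set Y -> \bar R}) :
  trivIset setT A -> (forall y, 0 <= g y) ->
  (\int[nu]_y (g y)%:E = \sum_(i <oo) (c i)%:E * nu (A i))%E.
Proof.
move=> tA g0; rewrite -AT ge0_integral_bigcup//; last 2 first.
- apply/measurable_EFinP; apply: measurable_funS measurable_fun_partition => //.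
- by move=> y _; rewrite lee_fin.
apply: eq_eseriesr => i _; rewrite -integral_cst//.
by apply: eq_integral => y /set_mem Ay; rewrite (gc Ay).
Qed.

End countable_partitions.

Lemma integral_prob_bounded (R : realType) d (Y : measurableType d)
    (nu : probability Y R) (f : Y -> R) (b : R) :
  measurable_fun setT f -> (forall y, 0 <= f y <= b) ->
  (0 <= \int[nu]_y (f y)%:E <= b%:E)%E.
Proof.
move=> mf fb; rewrite integral_ge0/=; last first.
  by move=> y _; rewrite lee_fin; have /andP[] := fb y.
have -> : b%:E = (\int[nu]_y b%:E)%E.
  by rewrite integral_cst// [X in (_ * X)%E]probability_setT mule1.
apply: ge0_le_integral => //.
- by move=> y _; rewrite lee_fin; have /andP[] := fb y.
- exact/measurable_EFinP.
- by move=> y _; rewrite lee_fin; have /andP[] := fb y.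
Qed.

Lemma integral_prob_fin_num (R : realType) d (Y : measurableType d)
    (nu : probability Y R) (f : Y -> R) (b : R) :
  measurable_fun setT f -> (forall y, 0 <= f y <= b) ->
  (\int[nu]_y (f y)%:E \is a fin_num)%E.
Proof.
move=> mf fb; have /andP[i0 ib] := integral_prob_bounded nu mf fb.
by rewrite ge0_fin_numE// (le_lt_trans ib)// ltry.
Qed.

Lemma subprob_seq_eq (R : realType) (p q : subprob_seq R) :
  (forall i, p i = q i) -> p = q.
Proof.
case: p q => [u u0 u1] [v v0 v1] /= /funext uv; subst v.
by congr SubprobSeq; exact: Prop_irrelevance.
Qed.

(** * The relations pi_n, their enumerated classes and the sigma-algebras F_n *)

Section algorithm.
Context {R : realType} {d : measure_display} {X : measurableType d} {T : set X}.
Variable pb : target_problem R T.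
Variable eps : nat -> R.
Variable sim : nat -> subprob_seq R -> subprob_seq R -> Prop.
Variable A : nat -> nat -> set X.
Hypothesis esim : forall n, (0 < n)%N -> eps_equivalence (eps n) (sim n).
Hypothesis eA : forall n, enumerates (A n) (rel_classes (algo_rel pb sim A n)).

Local Notation M := (g_sigma_algebraType (tp_sigma pb)).
Local Notation rel := (algo_rel pb sim A).
Local Notation cls n := (rel_class (rel n)).
Local Notation sigma := (algo_sigma pb sim A).
Local Notation Moo := (g_sigma_algebraType (\bigcup_n sigma n)).

Lemma algo_rel_sym n {y z} : rel n y z -> rel n z y.
Proof.
elim: n y z => [y z []//|n ih y z /= [/ih zy [p [q [pE qE]]]]].
have [[f _ ->] _] := esim (ltn0Sn n) => pq.
by split=> //; exists q, p; split.
Qed.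

Lemma algo_rel_trans n {x y z} : rel n x y -> rel n y z -> rel n x z.
Proof.
elim: n x y z => [x y z [? ?] [? ?]|n ih x y z /=]; first by split; auto.
move=> [/ih xy [p [q [pE qE pq]]]] [/xy xz [p' [q' [p'E q'E pq']]]].
split=> //; exists p, q'; split => //.
(* The middle point [y] comes with one profile from each hypothesis; both have the entries P(y,
   A_i), so they are the same element of S and the two [sim] steps can be chained. *)
have qp' : q = p'.
  by apply: subprob_seq_eq => i; apply: EFin_inj; rewrite qE p'E.
move: pq pq'; rewrite -qp'; have [[f _ ->] _] := esim (ltn0Sn n).
by rewrite /ker_rel => -> ->.
Qed.

Lemma measurable_class n x : measurable (cls n x : set M).
Proof. by apply: algo_rel_measurable => // k k0; have [] := esim k0. Qed.

Lemma enum_class n i z : A n i z -> A n i = cls n z.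
Proof.
move=> Az; have [y _ yA] : rel_classes (rel n) (A n i).
  have [[fA _ _]|[k [fA _ _] A0]] := eA n; first exact: fA.
  by have [/A0 A0i|/fA//] := leqP k i; rewrite A0i in Az.
move: Az; rewrite -yA /rel_class /= => yz; apply/seteqP; split => w /=.
  by apply: algo_rel_trans; exact: algo_rel_sym.
exact: algo_rel_trans.
Qed.

Lemma enum_trivIset n : trivIset setT (A n).
Proof.
move=> i j _ _ [z [iz jz]].
have ij : A n i = A n j by rewrite (enum_class iz) (enum_class jz).
have [[_ iA _]|[k [_ iA _] A0]] := eA n; first by apply: iA; rewrite ?inE.
have lk l : A n l z -> (l < k)%N.
  by move=> lz; rewrite ltnNge; apply/negP => /A0 l0; rewrite l0 in lz.
by apply: iA; rewrite ?inE//; exact: lk.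
Qed.

Lemma measurable_enum n i : measurable (A n i : set M).
Proof.
have [->|/set0P[z Az]] := eqVneq (A n i) set0; first exact: measurable0.
by rewrite (enum_class Az); exact: measurable_class.
Qed.

Lemma enum_of_class n z : exists i, A n i = cls n z.
Proof.
have cz : rel_classes (rel n) (cls n z) by exists z.
by have [[_ _ /(_ _ cz)[i _ <-]]|[k [_ _ /(_ _ cz)[i _ <-]] _]] := eA n;
  exists i.
Qed.

(** Unlike symmetry and transitivity, reflexivity must produce a profile: (P(x, A_i))_i belongs to S
    because the A_i are measurable and disjoint. Hence those facts are established before it. *)
Lemma algo_rel_refl n x : rel n x x.
Proof.
elim: n x => [//|n ih x] /=; split=> //.
have [Phi _ PhiE] := measurable_profile (measurable_enum n) (@enum_trivIset n).
exists (Phi x), (Phi x); split => //.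
by have [[f _ ->] _] := esim (ltn0Sn n).
Qed.

Lemma enum_cover n : \bigcup_i A n i = setT.
Proof.
apply/seteqP; split => // z _; have [i iz] := enum_of_class n z.
by exists i => //; rewrite iz; exact: algo_rel_refl.
Qed.

Lemma algo_rel_le m n y z : (m <= n)%N -> rel n y z -> rel m y z.
Proof.
move=> /subnK <-; elim: (n - m)%N => // k ih /=.
by move=> [/ih].
Qed.

Lemma sigma_enum n i : sigma n (A n i).
Proof.
have [->|/set0P[z Az]] := eqVneq (A n i) set0.
  by have [] := smallest_sigma_algebra setT (rel_classes (rel n)).
by rewrite (enum_class Az); apply: sub_sigma_algebra; exists z.
Qed.

(** A saturated set is the union of the enumerated classes that it contains. The enumeration makes
    this a countable union, the only kind that a generated sigma-algebra provides. *)
Lemma sigma_saturated n (F : set X) :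
  (forall y z, rel n y z -> F y -> F z) -> sigma n F.
Proof.
move=> Fsat.
have -> : F = \bigcup_i (if `[< A n i `<=` F >] then A n i else set0).
  apply/seteqP; split => [y Fy|y [i _]].
    have [i iy] := enum_of_class n y; exists i => //.
    case: asboolP => [_|]; first by rewrite iy; exact: algo_rel_refl.
    by case; rewrite iy => z /Fsat; exact.
  by case: asboolP => // iF /iF.
have [s0 _ sU] := smallest_sigma_algebra setT (rel_classes (rel n)).
by apply: sU => i; case: asboolP => // _; exact: sigma_enum.
Qed.

Lemma sigma_le m n : (m <= n)%N -> sigma m `<=` sigma n.
Proof.
move=> mn; apply: smallest_sub; first exact: smallest_sigma_algebra.
move=> _ [x _ <-]; apply: sigma_saturated => y z yz xy.
exact: (algo_rel_trans xy (algo_rel_le mn yz)).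
Qed.

Lemma measurable_sigma n F : sigma n F -> measurable (F : set Moo).
Proof. by move=> nF; apply: sub_sigma_algebra; exists n. Qed.

(** Every class of every pi_n lies in F, hence so does the join of the F_n. The kernels, which are
    measures on F, can thus integrate functions known to be measurable for the join. *)
Lemma measurable_fun_sigma (f : X -> R) :
  measurable_fun [set: Moo] f -> measurable_fun [set: M] f.
Proof.
move=> mf _ B mB; have := mf measurableT B mB; rewrite !setTI.
apply: smallest_sub; first exact: smallest_sigma_algebra.
move=> F [n _]; apply: smallest_sub; first exact: smallest_sigma_algebra.
by move=> _ [x _ <-]; exact: measurable_class.
Qed.

(** * Functions constant on the classes of some pi_n *)

Lemma class_function_values n (g : X -> R) (b : R) :
  (forall y z, rel n y z -> g y = g z) -> (forall y, 0 <= g y <= b) ->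
  exists c : nat -> R, (forall i, 0 <= c i <= b) /\
    (forall i y, A n i y -> g y = c i).
Proof.
move=> gr gb.
have /choice[c cP] : forall i, exists c,
    0 <= c <= b /\ (forall y, A n i y -> g y = c).
  move=> i; have [A0|/set0P[z Az]] := eqVneq (A n i) set0.
    (* Default value on an empty piece; it lies in the range because [g point] witnesses 0 <= b. *)
    exists 0; split => [|y]; last by rewrite A0.
    by have /andP[g0 g1] := gb point; rewrite lexx (le_trans g0 g1).
  exists (g z); split => // y; rewrite (enum_class Az) => zy.
  exact/esym/gr.
by exists c; split => i; have [] := cP i.
Qed.

Lemma class_function_measurable n (g : X -> R) :
  (forall y z, rel n y z -> g y = g z) -> measurable_fun [set: Moo] g.
Proof.
move=> gr _ B _; rewrite setTI; apply: (@measurable_sigma n).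
by apply: sigma_saturated => y z /gr; rewrite /preimage /= => ->.
Qed.

(* With g = c_i on A_i this is
   sum_i c_i p_i <= sum_i c_i q_i + b ||p - q||_1. *)
Lemma integral_ker_class_function n (g : X -> R) (b : R) y z :
  (forall y z, rel n y z -> g y = g z) -> (forall y, 0 <= g y <= b) ->
  rel n.+1 y z ->
  (\int[tp_ker pb y]_w (g w)%:E <=
   \int[tp_ker pb z]_w (g w)%:E + (b * eps n.+1)%:E)%E.
Proof.
move=> gr gb [_ [p [q [pE qE pq]]]].
have [c [cb gc]] := class_function_values gr gb.
have g0 w : 0 <= g w by have /andP[] := gb w.
have c0 i : 0 <= c i by have /andP[] := cb i.
have b0 : 0 <= b by have /andP[] := cb 0%N; exact: le_trans.
have PE w : (\int[tp_ker pb w]_v (g v)%:E =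
    \sum_(i <oo) (c i)%:E * tp_ker pb w (A n i))%E.
  by apply: (ge0_integral_partition (measurable_enum n) (enum_cover n) gc);
    [exact: enum_trivIset|].
rewrite !PE; under eq_eseriesr do rewrite -pE.
under [in leRHS]eq_eseriesr do rewrite -qE.
have [_ /(_ _ _ pq) /ltW pqe] := esim (ltn0Sn n).
apply: (@le_trans _ _ (\sum_(0 <= i <oo)
    ((c i)%:E * (q i)%:E + b%:E * `|p i - q i|%:E))%E).
  apply: lee_nneseries => i *.
    by rewrite -EFinM lee_fin mulr_ge0//; exact: sps_ge0.
  rewrite -!EFinM -EFinD lee_fin -lerBlDl -mulrBr.
  have /andP[_ cib] := cb i.
  by apply: (le_trans (ler_wpM2l (c0 i) (ler_norm _))); exact: ler_wpM2r.
rewrite nneseriesD => [|i _ _|i _ _]; last 2 first.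
- by rewrite -EFinM lee_fin mulr_ge0//; exact: sps_ge0.
- by rewrite -EFinM lee_fin mulr_ge0.
by rewrite leeD2l// nneseriesZl// EFinM lee_wpmul2l ?lee_fin.
Qed.

(** * Infima over classes and continuity along classes *)

Definition class_inf n (f : X -> R) (y : X) : R := inf (f @` cls n y).

Lemma class_inf_rel n f y z : rel n y z -> class_inf n f y = class_inf n f z.
Proof.
move=> yz; congr (inf (f @` _)); apply/seteqP; split => w /=.
  exact/algo_rel_trans/algo_rel_sym.
exact: algo_rel_trans.
Qed.

(** Nonnegativity supplies the lower bound without which [inf] could be a mere default value. *)
Lemma class_inf_le n f y : (forall z, 0 <= f z) -> class_inf n f y <= f y.
Proof.
move=> f0; apply: ge_inf; first by exists 0 => _ [z _ <-].
by exists y => //; exact: algo_rel_refl.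
Qed.

Lemma le_class_inf n f y e :
  (forall z, rel n y z -> e <= f z) -> e <= class_inf n f y.
Proof.
move=> ef; apply: lb_le_inf; last by move=> _ [z /ef yz <-].
by exists (f y), y => //; exact: algo_rel_refl.
Qed.

(** A one-sided bound suffices, since the infimum over the class of [y] never exceeds [f y]. *)
Lemma class_inf_cvg f y : (forall z, 0 <= f z) ->
  (forall e, 0 < e ->
    \forall n \near \oo, forall z, rel n y z -> f y <= f z + e) ->
  class_inf n f y @[n --> \oo] --> f y.
Proof.
move=> f0 fy; apply/cvgrPdist_le => e /fy; apply: filterS => n fe.
rewrite ger0_norm ?subr_ge0; last exact: class_inf_le.
rewrite lerBlDr -lerBlDl; apply: le_class_inf => z /fe.
by rewrite lerBlDl addrC.
Qed.

(** [f] is the pointwise limit of its class infima, and the n-th of these is constant on the classes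
    of pi_n. *)
Lemma measurable_fun_class_lsc (f : X -> R) : (forall z, 0 <= f z) ->
  (forall y e, 0 < e ->
    \forall n \near \oo, forall z, rel n y z -> f y <= f z + e) ->
  measurable_fun [set: Moo] f.
Proof.
move=> f0 fy; apply: (@measurable_fun_cvg _ Moo _ _ (class_inf ^~ f)).
  by move=> n; apply: class_function_measurable => y z; exact: class_inf_rel.
by move=> y _; apply: class_inf_cvg => // e; exact: fy.
Qed.

(* One-sided, but the classes are symmetric: the oscillation of f on each class
   of pi_n is at most e. *)
Definition class_unif_continuous (f : X -> R) := forall e, 0 < e ->
  \forall n \near \oo, forall y z, rel n y z -> f y <= f z + e.

Lemma class_unif_continuous_measurable (f : X -> R) : (forall z, 0 <= f z) ->
  class_unif_continuous f -> measurable_fun [set: Moo] f.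
Proof.
move=> f0 fu; apply: measurable_fun_class_lsc => // y e /fu.
by apply: filterS => n + z; exact.
Qed.

(** Let g be the infimum of [f] over classes of pi_n, with n so large that g <= f <= g + e/2. Since
    g is constant on these classes, passing from P(y, .) to P(z, .) costs at most b * eps_(n+1) <=
    e/2 when y and z are pi_(n+1)-equivalent. The form of the conclusion allows iteration. *)
Lemma class_unif_continuous_integral (f : X -> R) (b : R) :
  eps n @[n --> \oo] --> (0 : R) ->
  (forall z, 0 <= f z <= b) -> class_unif_continuous f ->
  exists f' : X -> R, [/\ forall y, 0 <= f' y <= b, class_unif_continuous f' &
    forall y, (\int[tp_ker pb y]_w (f w)%:E)%E = (f' y)%:E].
Proof.
move=> eps0 fb fu.
have f0 w : 0 <= f w by have /andP[] := fb w.
have mf := measurable_fun_sigma (class_unif_continuous_measurable f0 fu).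
have fin w := integral_prob_fin_num (tp_ker pb w) mf fb.
exists (fun y => fine (\int[tp_ker pb y]_w (f w)%:E)).
split => [y|e e0|y]; last by rewrite fineK.
  by rewrite -!lee_fin fineK//; exact: integral_prob_bounded.
have b0 : 0 <= b by have /andP[] := fb point; exact: le_trans.
have e20 : 0 < e / 2 by rewrite divr_gt0.
have be : \forall n \near \oo, b * eps n <= e / 2.
  have : b * eps n @[n --> \oo] --> b * 0 by exact: (cvgM (cvg_cst b) eps0).
  by rewrite mulr0 => /cvgr_le; apply.
have [N _ NP] := filterI be (fu _ e20).
(* Integration loses one index: closeness of [y] and [z] at level n+1 controls functions constant on
   classes of level n. *)
exists N.+1 => //= -[//|n] Nn y z yz.
have [_ fe] := NP n Nn; have [ben _] := NP n.+1 (leqW Nn).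
rewrite -lee_fin EFinD !fineK//.
have gb w : 0 <= class_inf n f w <= b.
  rewrite le_class_inf/=; last by move=> v _.
  by apply: le_trans (class_inf_le _ _ f0) _; have /andP[] := fb w.
have mg : measurable_fun [set: M] (class_inf n f).
  apply: measurable_fun_sigma; apply: (@class_function_measurable n) => u v.
  exact: class_inf_rel.
apply: (@le_trans _ _
  (\int[tp_ker pb y]_w ((class_inf n f w)%:E + (e / 2)%:E))%E).
  apply: ge0_le_integral => //.
  - by move=> w _; rewrite lee_fin.
  - exact/measurable_EFinP.
  - by apply: emeasurable_funD => //; exact/measurable_EFinP.
  - move=> w _; rewrite -EFinD lee_fin -lerBlDr.
    by apply: le_class_inf => v /fe; rewrite lerBlDr.
rewrite ge0_integralD//; last 3 first.
- by move=> w _; rewrite lee_fin; have /andP[] := gb w.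
- exact/measurable_EFinP.
- by move=> w _; rewrite lee_fin ltW.
rewrite integral_cst// [X in (_ * X)%E]probability_setT mule1.
rewrite [e in leRHS]splitr EFinD addeA; apply: leeD => //.
apply: le_trans (integral_ker_class_function _ gb yz) _ => [u v|].
  exact: class_inf_rel.
apply: leeD; last by rewrite lee_fin.
apply: ge0_le_integral => //.
- by move=> w _; rewrite lee_fin; have /andP[] := gb w.
- exact/measurable_EFinP.
- exact/measurable_EFinP.
- by move=> w _; rewrite lee_fin class_inf_le.
Qed.

(** * Iterated kernels and the shrinking of classes for d_P *)

Lemma ker_iter_unif_continuous k : eps n @[n --> \oo] --> (0 : R) ->
  exists f : X -> R, [/\ forall y, 0 <= f y <= 1, class_unif_continuous f &
    forall y, ker_iter pb k y T = (f y)%:E].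
Proof.
move=> eps0; elim: k => [|k [f [fb fu fE]]]; last first.
  have [f' [fb' fu' fE']] := class_unif_continuous_integral eps0 fb fu.
  exists f'; split => // y; rewrite -fE'.
  by apply: eq_integral => w _; exact: fE.
have indT : forall y, 0 <= (\1_T y : R) <= 1.
  by move=> y; rewrite indicE; case: (_ \in _); rewrite ?lexx ler01.
(* The induction starts from the indicator of T, constant on the classes of pi_0 and so of every
   pi_n; one integration gives P(., T), the iterate of index 0. *)
have indu : class_unif_continuous \1_T.
  move=> e e0; exists 0%N => // n _ y z /(algo_rel_le (leq0n n)) /= [Tyz Tzy].
  rewrite !indicE (_ : (y \in T) = (z \in T)) ?lerDl ?ltW//.
  by apply/idP/idP; rewrite !inE.
have [f [fb fu fE]] := class_unif_continuous_integral eps0 indT indu.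
exists f; split => // y; rewrite -fE integral_indic ?setIT//.
by apply: sub_sigma_algebra; exact: tp_target.
Qed.
(** The terms of d_P are dominated by beta^(k+1), so some tail is below e/2 uniformly in [y] and
    [z]. The finitely many remaining terms are made small together on the classes of pi_n, by
    continuity of each iterate along classes. *)
Lemma rho_dist_class (beta : R) (e : R) : 0 < beta < 1 ->
  eps n @[n --> \oo] --> (0 : R) -> 0 < e ->
  \forall n \near \oo, forall y z, rel n y z -> (rho_dist beta pb y z < e%:E)%E.
Proof.
move=> /andP[beta0 beta1] eps0 e0.
have /choice[f fP] := ker_iter_unif_continuous ^~ eps0.
have fb k y : 0 <= f k y <= 1 by have [] := fP k.
pose t k y z := beta ^+ k.+1 * `|f k y - f k z|.
have rhoE y z : (rho_dist beta pb y z = \sum_(0 <= k <oo) (t k y z)%:E)%E.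
  by apply: eq_eseriesr => k _; have [_ _ fE] := fP k; rewrite !fE.
have t0 k y z : 0 <= t k y z by rewrite mulr_ge0// exprn_ge0// ltW.
have tb k y z : t k y z <= beta ^+ k.+1.
  apply: ler_piMr; first by rewrite exprn_ge0// ltW.
  rewrite ler_norml.
  have /andP[y0 y1] := fb k y; have /andP[z0 z1] := fb k z.
  by apply/andP; split; lra.
have sum_lty : (\sum_(0 <= k <oo) (beta ^+ k.+1)%:E < +oo)%E.
  apply: (@le_lt_trans _ _ (beta * (1 - beta)^-1)%:E); last by rewrite ltry.
  apply: lime_le.
    by apply: is_cvg_nneseries => k _ _; rewrite lee_fin exprn_ge0// ltW.
  apply: nearW => n; rewrite sumEFin lee_fin.
  have -> : \sum_(0 <= k < n) beta ^+ k.+1 = series (geometric beta beta) n.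
    by rewrite seriesEnat; apply: eq_bigr => k _; rewrite exprS.
  by apply: geometric_le_lim; rewrite ?ger0_norm// ltW.
have e20 : 0 < e / 2 by rewrite divr_gt0.
have [K _ /(_ K (leqnn K)) tailK] : \forall K \near \oo,
    (\sum_(K <= k <oo) (beta ^+ k.+1)%:E < (e / 2)%:E)%E.
  have beta_ge0 k : true -> (0 <= (beta ^+ k.+1)%:E)%E.
    by rewrite lee_fin exprn_ge0// ltW.
  have tail0 := nneseries_tail_cvg sum_lty beta_ge0.
  apply: (tail0 [set u | (u < (e / 2)%:E)%E]).
  by apply: open_ereal_lt'; rewrite lte_fin.
have : forall e', 0 < e' -> \forall n \near \oo, forall y z, rel n y z ->
    \sum_(0 <= k < K) t k y z <= e'.
  (* Induction on the number of terms, giving half of the allowance to the last term. *)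
  elim: (K) => [|k ih] e' e'0.
    by apply: nearW => n y z _; rewrite big_geq// ltW.
  have e'20 : 0 < e' / 2 by rewrite divr_gt0.
  have [_ fu _] := fP k.
  near=> n => y z yz; rewrite big_nat_recr//= [e']splitr lerD//.
    by move: y z yz; near: n; exact: ih.
  apply: (@le_trans _ _ `|f k y - f k z|).
    by apply: ler_piMl => //; rewrite exprn_ile1// ltW.
  rewrite ler_norml.
  have H : forall y z, rel n y z -> f k y <= f k z + e' / 2.
    by near: n; exact: fu.
  have := H _ _ yz; have := H _ _ (algo_rel_sym yz).
  by move=> ? ?; apply/andP; split; lra.
move=> /(_ _ e20); apply: filterS => n tK y z /tK tKe.
rewrite rhoE (nneseries_split 0 K) ?add0n; last by move=> k _; rewrite lee_fin.
rewrite [e]splitr EFinD sumEFin; apply: lee_ltD => //.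
apply: le_lt_trans tailK.
by apply: lee_nneseries => k *; rewrite lee_fin.
Unshelve. all: by end_near. Qed.

Lemma eps_ge0 n : 0 <= eps n.+1.
Proof.
(* [sim n.+1] is a kernel relation, hence reflexive: a point of S is at a nonnegative distance from
   itself, and that distance is below [eps n.+1]. *)
have [[f _ simE] /(_ point point)] := esim (ltn0Sn n).
rewrite simE => /(_ erefl)/ltW; rewrite -lee_fin; apply: le_trans.
exact: nneseries_ge0.
Qed.

Lemma class_function_unif_continuous m (g : X -> R) :
  (forall y z, rel m y z -> g y = g z) -> class_unif_continuous g.
Proof.
move=> gr e e0; exists m => // n mn y z /(algo_rel_le mn)/gr ->.
by rewrite lerDl ltW.
Qed.

(** * Averaging the kernel over a class, and weak convergence of arbitrary extensions *)

Section weak_convergence.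
Variable mu : probability Moo R.
Hypothesis mu_gt0 : forall n F, sigma n F -> F !=set0 -> (0 < mu F)%E.
Variable x : X.
Variables (nu : nat -> probability Moo R) (nuoo : probability Moo R).
Hypothesis nuE : forall n F, sigma n F -> nu n F = algo_ker mu n x F.
Hypothesis nuooE : forall n F, sigma n F -> nuoo F = tp_ker pb x F.
Hypothesis eps0 : eps n @[n --> \oo] --> (0 : R).

(** The kernel is given as F-measurable, whereas [mu] lives on the join of the F_n. Measurability
    for the join comes from continuity along classes, preserved when the indicator of A_i is
    integrated. *)
Lemma measurable_fun_ker_enum m i :
  measurable_fun [set: Moo] (fun y => tp_ker pb y (A m i)).
Proof.
have Ab y : 0 <= (\1_(A m i) y : R) <= 1.
  by rewrite indicE; case: (_ \in _); rewrite ?lexx ler01.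
have Au : class_unif_continuous \1_(A m i).
  apply: (@class_function_unif_continuous m) => y z yz.
  rewrite !indicE; congr (_%:R); congr nat_of_bool; apply/idP/idP; rewrite !inE.
    by move=> /enum_class ->.
  by move=> /enum_class ->; exact: algo_rel_sym.
have [f [fb fu fE]] := class_unif_continuous_integral eps0 Ab Au.
rewrite (_ : (fun _ => _) = EFin \o f); last first.
  apply/funext => y; rewrite /= -fE integral_indic ?setIT//.
  exact: measurable_enum.
apply/measurable_EFinP; apply: class_unif_continuous_measurable => // y.
by have /andP[] := fb y.
Qed.

(** The integral of [g] against [nu n] is the mu-average over [x]_n of y |-> \int g dP(y, .). Since
    m < n, [g] is constant on the classes of pi_(n-1), so on [x]_n this integrand is at least its
    value at x minus b * eps_n; that value is the integral against [nuoo]. *)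
Lemma integral_class_function_le m n (g : X -> R) (b : R) : (m < n)%N ->
  (forall y z, rel m y z -> g y = g z) -> (forall y, 0 <= g y <= b) ->
  (\int[nuoo]_y (g y)%:E <= \int[nu n]_y (g y)%:E + (b * eps n)%:E)%E.
Proof.
move=> mn gr gb.
have [c [cb gc]] := class_function_values gr gb.
have g0 w : 0 <= g w by have /andP[] := gb w.
have c0 i : 0 <= c i by have /andP[] := cb i.
pose G y := (\int[tp_ker pb y]_w (g w)%:E)%E.
have mA i : measurable (A m i : set Moo).
  exact: (measurable_sigma (@sigma_enum m i)).
have GE y : (G y = \sum_(i <oo) (c i)%:E * tp_ker pb y (A m i))%E.
  by apply: (ge0_integral_partition (@measurable_enum m) (enum_cover m) gc);
    [exact: enum_trivIset|].
have nuooG : (\int[nuoo]_y (g y)%:E = G x)%E.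
  rewrite GE (ge0_integral_partition mA (enum_cover m) gc)//; last first.
    exact: enum_trivIset.
  apply: eq_eseriesr => i _; congr (_ * _)%E.
  by apply: (@nuooE m); exact: (@sigma_enum m i).
pose C := cls n x.
have mC : measurable (C : set Moo).
  by apply: (@measurable_sigma n); apply: sub_sigma_algebra; exists x.
have muC0 : (0 < mu C)%E.
  apply: (mu_gt0 (n := n)); first by apply: sub_sigma_algebra; exists x.
  by exists x; exact: algo_rel_refl.
have muC_fin : mu C \is a fin_num by exact: fin_num_measure.
have fmuC0 : 0 < fine (mu C) by rewrite -lte_fin fineK.
have mG i : measurable_fun (C : set Moo)
    (fun y => (c i)%:E * tp_ker pb y (A m i))%E.
  apply: measurable_funeM; apply: measurable_funTS.
  exact: measurable_fun_ker_enum.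
(* The averaging formula for P_n(x, A_i) extends to [g] by summation over i, as the A_i belong to
   F_m and hence to F_n. *)
have nuG : (\int[nu n]_y (g y)%:E =
    ((fine (mu C))^-1)%:E * \int[mu]_(y in C) G y)%E.
  rewrite (ge0_integral_partition mA (enum_cover m) gc)//; last first.
    exact: enum_trivIset.
  under [in RHS]eq_integral do rewrite GE.
  rewrite integral_nneseries//; last first.
    by move=> i y _; rewrite mule_ge0// lee_fin.
  rewrite -nneseriesZl; last first.
    move=> i _; apply: integral_ge0 => y _.
    by rewrite mule_ge0// lee_fin.
  apply: eq_eseriesr => i _.
  transitivity ((c i)%:E * algo_ker mu n x (A m i))%E.
    congr (_ * _)%E; apply: nuE.
    exact: (sigma_le (ltnW mn) (@sigma_enum m i)).
  rewrite ge0_integralZl//; last 2 first.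
  - by apply: measurable_funTS; exact: measurable_fun_ker_enum.
  - by rewrite lee_fin.
  by rewrite muleCA.
have [f [fb fu fE]] :=
  class_unif_continuous_integral eps0 gb (class_function_unif_continuous gr).
have f0 y : 0 <= f y by have /andP[] := fb y.
have mf := class_unif_continuous_measurable f0 fu.
have b0 : 0 <= b by exact: le_trans (f0 x) (andP (fb x)).2.
have be0 : 0 <= b * eps n by case: (n) mn => // k _; rewrite mulr_ge0// eps_ge0.
have fC y : rel n x y -> f x <= f y + b * eps n.
  case: (n) mn => // k mk xy.
  rewrite -lee_fin EFinD -!fE; apply: (integral_ker_class_function _ gb xy).
  by move=> u v uv; apply: gr; exact: algo_rel_le uv.
(* The pointwise bound is integrated over C; dividing by mu(C) > 0 then turns it into the bound on
   averages. *)
have intC : ((f x)%:E * mu C <=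
    \int[mu]_(y in C) (f y)%:E + (b * eps n)%:E * mu C)%E.
  rewrite -!integral_cst// -ge0_integralD//; last 2 first.
  - by move=> y _; rewrite lee_fin.
  - by apply/measurable_EFinP; exact: measurable_funTS.
  apply: ge0_le_integral => //.
  - by move=> y _; rewrite lee_fin.
  - apply: emeasurable_funD => //; apply/measurable_EFinP.
    exact: measurable_funTS.
have GCE : (\int[mu]_(y in C) G y = \int[mu]_(y in C) (f y)%:E)%E.
  by apply: eq_integral => y _; exact: fE.
have muCV : (mu C * ((fine (mu C))^-1)%:E = 1)%E.
  by rewrite -{1}(fineK muC_fin) -EFinM mulfV ?gt_eqF.
have VC0 : (0 <= ((fine (mu C))^-1)%:E)%E by rewrite lee_fin invr_ge0 ltW.
have := lee_wpmul2r VC0 intC.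
rewrite ge0_muleDl; last 2 first.
- by apply: integral_ge0 => y _; rewrite lee_fin.
- by rewrite mule_ge0// lee_fin.
by rewrite -!muleA muCV !mule1 nuooG nuG GCE {1}/G fE muleC.
Qed.

(** Dominated convergence under [nuoo] fixes m at a cost of e/2; then n grows until b * eps_n <=
    e/2. The choice of extension is harmless: [nu n] is evaluated on the class infimum, where P_n
    decides, and [h] enters only as an upper bound for it. *)
Lemma integral_cvg_lower (h : X -> R) (b e : R) :
  (forall y, 0 <= h y <= b) ->
  (forall y e, 0 < e ->
    \forall n \near \oo, forall z, rel n y z -> h y <= h z + e) ->
  0 < e ->
  \forall n \near \oo,
    (\int[nuoo]_y (h y)%:E <= \int[nu n]_y (h y)%:E + e%:E)%E.
Proof.
move=> hb hc e0.
have h0 y : 0 <= h y by have /andP[] := hb y.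
have b0 : 0 <= b by exact: le_trans (h0 x) (andP (hb x)).2.
have mh := measurable_fun_class_lsc h0 hc.
have gb m w : 0 <= class_inf m h w <= b.
  rewrite le_class_inf/=; last by move=> v _.
  by apply: le_trans (class_inf_le _ _ h0) _; have /andP[] := hb w.
have mg m : measurable_fun [set: Moo] (class_inf m h).
  by apply: (@class_function_measurable m) => u v; exact: class_inf_rel.
have fin := integral_prob_fin_num nuoo mh hb.
have [_ _ gh] : [/\ nuoo.-integrable setT (EFin \o h),
    [sequence \int[nuoo]_y `|(class_inf m h y)%:E - (h y)%:E|]_m @ \oo --> 0 &
    [sequence \int[nuoo]_y (class_inf m h y)%:E]_m @ \oo -->
    \int[nuoo]_y (h y)%:E]%E.
  apply: (@dominated_convergence _ _ _ nuoo setT _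
      (fun m y => (class_inf m h y)%:E) (EFin \o h) (EFin \o cst b)) => //.
  - by move=> m; exact/measurable_EFinP.
  - exact/measurable_EFinP.
  - apply: aeW => y _; apply: cvg_EFin; first exact: nearW.
    by apply: class_inf_cvg => // e' ; exact: hc.
  - exact: finite_measure_integrable_cst.
  - apply: aeW => y m _ /=.
    by rewrite lee_fin ger0_norm; have /andP[] := gb m y.
have e20 : 0 < e / 2 by rewrite divr_gt0.
have [m _ /(_ m (leqnn m)) hm] : \forall m \near \oo,
    (\int[nuoo]_y (h y)%:E - (e / 2)%:E < \int[nuoo]_y (class_inf m h y)%:E)%E.
  apply: (gh [set u | (\int[nuoo]_y (h y)%:E - (e / 2)%:E < u)%E]).
  by apply: open_ereal_gt'; rewrite lteBlDr// lteDl// lte_fin.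
have be : \forall n \near \oo, b * eps n <= e / 2.
  have : b * eps n @[n --> \oo] --> b * 0 by exact: (cvgM (cvg_cst b) eps0).
  by rewrite mulr0 => /cvgr_le; apply.
near=> n.
have mn : (m < n)%N by near: n; exact: nbhs_infty_gt.
move: hm; rewrite lteBlDr// => /ltW/le_trans; apply.
rewrite [e in leRHS]splitr EFinD addeA leeD2r//.
apply: (@le_trans _ _ (\int[nu n]_y (class_inf m h y)%:E + (b * eps n)%:E))%E.
  apply: (integral_class_function_le mn _ (gb m)) => u v.
  exact: class_inf_rel.
apply: leeD; last by rewrite lee_fin; near: n.
apply: ge0_le_integral => //.
- by move=> w _; rewrite lee_fin; have /andP[] := gb m w.
- exact/measurable_EFinP.
- exact/measurable_EFinP.
- by move=> w _; rewrite lee_fin class_inf_le.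
Unshelve. all: by end_near. Qed.

Lemma integral_cvg_class_continuous (h : X -> R) (b : R) :
  (forall y, `|h y| <= b) ->
  (forall y e, 0 < e ->
    \forall n \near \oo, forall z, rel n y z -> `|h y - h z| <= e) ->
  (\int[nu n]_y (h y)%:E @[n --> \oo] --> \int[nuoo]_y (h y)%:E)%E.
Proof.
move=> hb hc.
(* Both h + b and b - h are nonnegative, so the lower bound applies to each and gives the two halves
   of the convergence. *)
have hpb y : 0 <= h y + b <= b + b.
  by have := hb y; rewrite ler_norml => /andP[? ?]; apply/andP; split; lra.
have hmb y : 0 <= b - h y <= b + b.
  by have := hb y; rewrite ler_norml => /andP[? ?]; apply/andP; split; lra.
have hpc y e : 0 < e ->
    \forall n \near \oo, forall z, rel n y z -> h y + b <= h z + b + e.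
  move=> /(hc y); apply: filterS => n hn z /hn; rewrite ler_norml => /andP[? ?].
  lra.
have hmc y e : 0 < e ->
    \forall n \near \oo, forall z, rel n y z -> b - h y <= b - h z + e.
  move=> /(hc y); apply: filterS => n hn z /hn; rewrite ler_norml => /andP[? ?].
  lra.
have mh : measurable_fun [set: Moo] h.
  rewrite (_ : h = fun y => (h y + b) - b); last by apply/funext => y; lra.
  apply: measurable_funB => //; apply: measurable_fun_class_lsc => // y.
  by have /andP[] := hpb y.
have ib (P : probability Moo R) : P.-integrable setT (EFin \o cst b).
  exact: finite_measure_integrable_cst.
have ih (P : probability Moo R) : P.-integrable setT (EFin \o h).
  apply: (le_integrable _ _ _ (ib P)) => //; first exact/measurable_EFinP.
  by move=> y _; rewrite /= lee_fin (le_trans (hb y))// ler_norm.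
have bE (P : probability Moo R) : (\int[P]_y b%:E = b%:E)%E.
  by rewrite integral_cst// [X in (_ * X)%E]probability_setT mule1.
have fin (P : probability Moo R) : (\int[P]_y (h y)%:E)%E \is a fin_num.
  exact: (integrable_fin_num measurableT (ih P)).
have pE (P : probability Moo R) :
    (\int[P]_y (h y + b)%:E = (fine (\int[P]_y (h y)%:E) + b)%:E)%E.
  rewrite EFinD fineK// -[in RHS](bE P).
  exact: (integralD_EFin measurableT (ih P) (ib P)).
have mE (P : probability Moo R) :
    (\int[P]_y (b - h y)%:E = (b - fine (\int[P]_y (h y)%:E))%:E)%E.
  rewrite EFinB fineK// -[in RHS](bE P).
  exact: (integralB_EFin measurableT (ib P) (ih P)).
rewrite -[X in _ --> X]fineK//; apply/fine_cvgP; split; first exact: nearW.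
apply/cvgrPdist_le => e e0.
near=> n.
have : (\int[nuoo]_y (h y + b)%:E <= \int[nu n]_y (h y + b)%:E + e%:E)%E.
  by near: n; exact: integral_cvg_lower hpb hpc e0.
have : (\int[nuoo]_y (b - h y)%:E <= \int[nu n]_y (b - h y)%:E + e%:E)%E.
  by near: n; exact: integral_cvg_lower hmb hmc e0.
rewrite !pE !mE -!EFinD !lee_fin ler_norml /= => ? ?.
by apply/andP; split; lra.
Unshelve. all: by end_near. Qed.

End weak_convergence.

End algorithm.

(** * Total convergence for the topology induced by d_P *)

Theorem theorem5 (R : realType) (d : measure_display) (X : measurableType d)
    (T : set X) (mT : measurable T) (hA0 : assumption_A0 R X)
    (beta : R) (beta01 : 0 < beta < 1)
    (pb : target_problem R T) (Str : strategy R T)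
    (hStr : target_algorithm Str) (x : X) :
  totally_cvg (Y := rho_space beta01 pb)
    (G := fun n => tp_sigma (Str n pb))
    (fun n => tp_ker (Str n pb) x)
    (restrict_prob (target_algorithm_sub (pb := pb) hStr) (tp_ker pb x)).
Proof.
have [eps [sim [_ eps0 esim /(_ pb)[A eA [mu [mu_gt0 sE kE]]]]]] := hStr.
move=> nub nubE h hc [b hb].
have {nubE kE} nubE n F : algo_sigma pb sim A n F ->
    nub n F = algo_ker mu n x F.
  by move=> nF; rewrite nubE ?sE// kE.
have nuooE n F : algo_sigma pb sim A n F ->
    restrict_prob (target_algorithm_sub (pb := pb) hStr) (tp_ker pb x) F =
    tp_ker pb x F.
  by [].
(* A d_P-ball around [y] on which [h] varies by at most e contains the pi_n-class of [y] for all
   large n. *)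
have class_continuous y e : 0 < e -> \forall n \near \oo, forall z,
    algo_rel pb sim A n y z -> `|h y - h z| <= e.
  move=> e0.
  have /cvgrPdist_le/(_ _ e0)/nbhs_ballP[r /= r0 rh] := hc y.
  have := rho_dist_class esim eA beta01 eps0 r0.
  by apply: filterS => n nr z /nr; exact: rh.
(* The limit measure is generalized, keeping only its values on each F_n, so that the filtration
   occurring in its type can be replaced by [algo_sigma pb sim A]. *)
move: (restrict_prob _ _) nuooE => nuoo nuooE.
move: nub nuoo nubE nuooE.
have -> : (fun n => tp_sigma (Str n pb)) = algo_sigma pb sim A.
  by apply/funext => n; rewrite sE.
move=> nub nuoo nubE nuooE.
exact: (integral_cvg_class_continuous esim eA mu_gt0 nubE nuooE eps0 hb).
Qed.
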